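(* Let $V$ be a ground set of $n$ elements, $f$ a nonnegative monotone submodular function on $V$, and $m$ a positive integer. Any partition of $V$ into $m$ sets $S_1,\dots,S_m$ each of size at most $\lceil n/m\rceil$ satisfies $\max_i f(S_i)\le \min\left(m,\lceil n/m\rceil\right)\cdot B$, where $B$ is the optimal value of the uniform Submodular Load Balancing problem on $(V,f,m)$. That is, the algorithm that partitions the elements into $m$ arbitrary sets of size at most $\lceil n/m\rceil$ is a $\min(m,\lceil n/m\rceil)$-approximation.
   Context: $f:2^V\to\mathbb{R}_{\ge0}$ is submodular if $f(S)+f(T)\ge f(S\cup T)+f(S\cap T)$ for all $S,T$, and monotone if $f(S)\le f(T)$ whenever $S\subseteq T$. Uniform Submodular Load Balancing: find a partition of $V$ into $m$ (possibly empty) sets $V_1,\dots,V_m$ minimizing $\max_i f(V_i)$; $B$ denotes the minimum value.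
   Formalization: The ground set V is assumed nonempty (n ≥ 1), since for n = 0 and f(∅) > 0 the factor min(m, ⌈n/m⌉) is 0 while max_i f(S_i) = B = f(∅) > 0, so the inequality fails. *)

(* Defs.v *)
From HB Require Import structures.
From mathcomp Require Import all_boot all_order all_algebra.
From mathcomp Require Import reals zify.

Set Implicit Arguments.
Unset Strict Implicit.
Unset Printing Implicit Defensive.

Import Order.TTheory GRing.Theory Num.Theory.

Local Open Scope ring_scope.

Definition submodular (R : realType) (V : finType) (f : {set V} -> R) : Prop :=
  forall S T : {set V}, f (S :|: T) + f (S :&: T) <= f S + f T.

Definition monotone (R : realType) (V : finType) (f : {set V} -> R) : Prop :=
  forall S T : {set V}, S \subset T -> f S <= f T.

Definition nonnegative (R : realType) (V : finType) (f : {set V} -> R) : Prop :=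
  forall S : {set V}, 0 <= f S.

(* An indexed family rather than finset's [partition], which forbids empty
   blocks. *)
Definition m_partition (V : finType) (m : nat) (S : 'I_m -> {set V}) : Prop :=
  (forall i j : 'I_m, i != j -> [disjoint S i & S j]) /\
  \bigcup_(i < m) S i = [set: V].

(* The default value 0 is harmless when m > 0 and f is nonnegative: see
   [max_load_attained]. *)
Definition max_load (R : realType) (V : finType) (f : {set V} -> R) (m : nat)
    (S : 'I_m -> {set V}) : R :=
  \big[Num.max/0]_(i < m) f (S i).

Definition slb_opt (R : realType) (V : finType) (f : {set V} -> R) (m : nat)
    (B : R) : Prop :=
  (exists2 P : 'I_m -> {set V}, m_partition P & max_load f P = B) /\
  (forall P : 'I_m -> {set V}, m_partition P -> B <= max_load f P).

Definition ceil_div (n m : nat) : nat := ((n + m.-1) %/ m)%N.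

Lemma ceil_divE (n m : nat) : (0 < m)%N ->
  (ceil_div n m)%:Z = Num.ceil (n%:R / m%:R : rat).
Proof.
move=> m0; apply/esym/ceil_def.
have m0' : 0 < m%:R :> rat by rewrite ltr0n.
rewrite ltr_pdivlMr // ler_pdivrMr //.
have -> : ((ceil_div n m)%:Z - 1)%:~R = (ceil_div n m)%:R - 1 :> rat.
  by rewrite intrB.
rewrite -[(Posz _)%:~R]/((ceil_div n m)%:R) mulrBl mul1r ltrBlDr -natrM -natrD.
rewrite ltr_nat ler_nat /ceil_div.
have := divn_eq (n + m.-1) m; have := ltn_pmod (n + m.-1) m0.
by set q := (_ %/ m)%N; set r := (_ %% m)%N; lia.
Qed.

Lemma max_load_attained (R : realType) (V : finType) (f : {set V} -> R)
    (m : nat) (S : 'I_m -> {set V}) :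
  (0 < m)%N -> nonnegative f ->
  (forall i, f (S i) <= max_load f S) /\ exists i, max_load f S = f (S i).
Proof.
case: m S => // m S _ f0; split=> [i|]; first exact: le_bigmax.
have [i _ iE] := @eq_bigmax _ R _ 0 ord0 xpredT (fun i => f (S i)) isT
  (fun i _ => f0 (S i)).
by exists i.
Qed.

Lemma slb_opt_exists (R : realType) (V : finType) (f : {set V} -> R)
    (m : nat) : (0 < m)%N -> exists B, slb_opt f m B.
Proof.
case: m => // m _.
pose part (P : {ffun 'I_m.+1 -> {set V}}) :=
  [forall i, forall j, (i != j) ==> [disjoint P i & P j]] &&
  (\bigcup_i P i == [set: V]).
have partP (P : {ffun _}) : reflect (m_partition P) (part P).
  apply: (iffP andP) => -[H1 H2]; split.
  - by move=> i j; move/forallP: H1 => /(_ i)/forallP/(_ j)/implyP.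
  - exact/eqP.
  - by apply/forallP => i; apply/forallP => j; apply/implyP; apply: H1.
  - exact/eqP.
pose P0 := [ffun i : 'I_m.+1 => if i == ord0 then [set: V] else set0].
have part0 : part P0.
  apply/partP; split.
    move=> i j ij; rewrite !ffunE -setI_eq0.
    case: (eqVneq i ord0) => [i0|_]; last by rewrite set0I.
    by rewrite -i0 [j == i]eq_sym (negPf ij) setI0.
  apply/eqP; rewrite -subTset; apply/subsetP => x _.
  by apply/bigcupP; exists ord0; rewrite // ffunE eqxx inE.
have [P pP Pmin] := @Order.TotalTheory.arg_minP _ R _ P0 part
  (fun P => max_load f P) part0.
exists (max_load f P); split; first by exists P => //; apply/partP.
move=> Q [Q1 Q2]; have QE : finfun Q =1 Q by move=> i; rewrite ffunE.
have -> : max_load f Q = max_load f (finfun Q).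
  by apply: eq_bigr => i _; rewrite QE.
apply: Pmin; apply/partP; split=> [i j ij|]; first by rewrite !QE; apply: Q1.
by rewrite -Q2; apply: eq_bigr => i _; rewrite QE.
Qed.

(* Main.v *)
(** Every block of an optimal partition has value at most [B], hence so does
    every singleton, by monotonicity.  Subadditivity then bounds [f (S i)] in
    two ways: [S i] is contained in the union of the [m] optimal blocks, and it
    is a union of at most [ceil (n / m)] singletons. *)
Require Import Defs.
From HB Require Import structures.
From mathcomp Require Import all_boot all_order all_algebra.
From mathcomp Require Import reals.

Import Order.TTheory GRing.Theory Num.Theory.

Local Open Scope ring_scope.

(* Subtracting [f set0] makes subadditivity hold for empty unions as well. *)
Lemma submodular_bigcup (R : realType) (V I : finType) (f : {set V} -> R)
    (A : {set I}) (F : I -> {set V}) :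
  monotone f -> submodular f ->
  f (\bigcup_(i in A) F i) - f set0 <= \sum_(i in A) (f (F i) - f set0).
Proof.
move=> f_mono f_submod.
elim/big_rec2: _ => [|i X x _ le_X]; first by rewrite subrr.
apply: le_trans (lerD (lexx _) le_X).
rewrite addrA lerD2r addrAC lerBrDr.
apply: le_trans (f_submod _ _).
(* Submodularity leaves the value of the intersection, which is at least [f set0]. *)
by rewrite lerD2l; apply/f_mono/sub0set.
Qed.

(** Each of the [#|A|] increments is at most [B - f set0], which is nonnegative, so [#|A|] may be
    raised to [k]. *)
Lemma submodular_bigcup_le (R : realType) (V I : finType) (f : {set V} -> R)
    (A : {set I}) (F : I -> {set V}) (k : nat) (B : R) :
  nonnegative f -> monotone f -> submodular f ->
  (0 < k)%N -> (#|A| <= k)%N -> f set0 <= B ->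
  (forall i, i \in A -> f (F i) <= B) ->
  f (\bigcup_(i in A) F i) <= k%:R * B.
Proof.
move=> f_ge0 f_mono f_submod k_gt0 le_Ak f0B FB.
have: f (\bigcup_(i in A) F i) - f set0 <= k%:R * (B - f set0).
  apply: le_trans (submodular_bigcup _ _ _ _ _ _ f_mono f_submod) _.
  apply: (@le_trans _ _ (\sum_(i in A) (B - f set0))).
    by apply: ler_sum => i Ai; rewrite lerD2r FB.
  by rewrite sumr_const -[_ *+ _]mulr_natl ler_wpM2r ?subr_ge0 ?ler_nat.
(* What remains beyond [k%:R * B] is [f set0 - k%:R * f set0], nonpositive because [1 <= k]. *)
rewrite lerBlDr mulrBr => /le_trans; apply.
by rewrite -addrA gerDl addrC subr_le0 ler_peMl ?ler1n.
Qed.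

Theorem theorem18 (R : realType) (V : finType) (f : {set V} -> R) (m : nat)
    (B : R) (S : 'I_m -> {set V})
    (V_gt0 : (0 < #|V|)%N) (m_gt0 : (0 < m)%N)
    (f_ge0 : nonnegative f) (f_mono : monotone f) (f_submod : submodular f)
    (B_opt : slb_opt f m B)
    (S_part : m_partition S)
    (S_size : forall i : 'I_m, (#|S i| <= ceil_div #|V| m)%N) :
  max_load f S <= (minn m (ceil_div #|V| m))%:R * B.
Proof.
have [[P [_ P_cover] PB] _] := B_opt.
have P_le j : f (P j) <= B.
  by rewrite -PB; have [] := max_load_attained P m_gt0 f_ge0.
have f0B : f set0 <= B.
  exact: le_trans (f_mono _ _ (sub0set (P (Ordinal m_gt0)))) (P_le _).
have f1B x : f [set x] <= B.
  have /bigcupP[j _ xPj] : x \in \bigcup_(j < m) P j by rewrite P_cover inE.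
  by apply: le_trans (f_mono _ _ _) (P_le j); rewrite sub1set.
(* Since [V] is nonempty, the numerator [#|V| + m.-1] is at least [m]. *)
have ceil_gt0 : (0 < ceil_div #|V| m)%N.
  by rewrite divn_gt0 // -[X in (X <= _)%N](prednK m_gt0) -add1n leq_add2r.
have [_ [i ->]] := max_load_attained S m_gt0 f_ge0.
rewrite /minn; case: ltnP => _.
  apply: le_trans (f_mono _ _ (subsetT _)) _; rewrite -P_cover.
  (* The union over all indices becomes one over the set [[set: 'I_m]], of cardinality [m]. *)
  rewrite -(eq_bigl _ _ (@in_setT 'I_m)).
  by apply: submodular_bigcup_le; rewrite ?cardsT ?card_ord.
rewrite -(_ : \bigcup_(x in S i) [set x] = S i); first exact: submodular_bigcup_le.
by apply/setP => x; apply/bigcupP/idP => [[y Sy /set1P->]|Sx] //; exists x; rewrite ?inE.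
Qed.
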